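(* Let $M={}_{f_2}M_1\times_{f_1}M_2$ be a pseudo-Riemannian doubly warped product with metric $g=f_2^2g_1+f_1^2g_2$. Let $\zeta_i\in\mathfrak X(M_i)$ be homothetic vector fields on $(M_i,g_i)$ with factors $a_i$, for each $i=1,2$. Assume that $\zeta_1(f_1)=\zeta_2(f_2)=0$. Then $\zeta=a_2\zeta_1+a_1\zeta_2$ is a homothetic vector field on $(M,g)$ with factor $a_1a_2$.
   Context: $(M_1,g_1)$ and $(M_2,g_2)$ are pseudo-Riemannian manifolds and $f_i:M_i\to(0,\infty)$ are smooth functions. The doubly warped product is $M_1\times M_2$ with metric $g=(f_2\circ\pi_2)^2\pi_1^*g_1+(f_1\circ\pi_1)^2\pi_2^*g_2$, where $\pi_i$ is the projection onto $M_i$; functions on $M_i$ are identified with their pullbacks, and vector fields on $M_i$ with their lifts to $M$. A vector field $\zeta$ on $(N,h)$ is homothetic with factor $a$ (a real constant) if $\mathcal L_\zeta h=a\,h$. *)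

(* Defs.v *)
From HB Require Import structures.
From mathcomp Require Import all_boot all_order all_algebra.
From mathcomp Require Import boolp classical_sets functions cardinality reals interval_inference.
From mathcomp Require Import topology normedtype landau derive.

Set Implicit Arguments.
Unset Strict Implicit.
Unset Printing Implicit Defensive.

Import Order.TTheory GRing.Theory Num.Theory.
Import numFieldNormedType.Exports.

Local Open Scope classical_set_scope.
Local Open Scope ring_scope.

Section SmoothMaps.
Context {R : realType}.

Fixpoint diff_on (k : nat) (V W : normedModType R) (U : set V) (f : V -> W) :
    Prop :=
  (forall x, U x -> differentiable f x) /\
  (if k is k'.+1 then forall v, diff_on k' U ('D_v f) else True).

(* On an open set [U] of a finite-dimensional space this is C^oo: a
   differentiable function is continuous, so all iterated partial derivatives
   exist and are continuous on [U]. *)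
Definition smooth_on (V W : normedModType R) (U : set V) (f : V -> W) : Prop :=
  forall k, diff_on k U f.

Section Closure.
Variables V W : normedModType R.
Implicit Types (U : set V) (f g : V -> W).

Lemma diff_on0 k U f x : diff_on k U f -> U x -> differentiable f x.
Proof. by case: k => [|k] [df _]; exact: df. Qed.

Lemma diff_onW k U f : diff_on k.+1 U f -> diff_on k U f.
Proof.
elim: k f => [|k IH] f [df ddf]; split=> // v.
by apply: IH; exact: ddf.
Qed.

Lemma smooth_on_sub U U' f : U `<=` U' -> smooth_on U' f -> smooth_on U f.
Proof.
move=> UU' sf k; elim: k f {sf}(sf k) => [|k IH] f [df ddf].
  by split=> // x /UU'; exact: df.
by split=> [x /UU'|v]; [exact: df|apply: IH; exact: ddf].
Qed.

End Closure.

Lemma linear_rV_differentiable n (W : normedModType R)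
    (L : {linear 'rV[R]_n -> W}) x : differentiable L x.
Proof.
have -> : (L : _ -> W) = \sum_(j < n)
    (fun u : 'rV[R]_n => u ord0 j *: L (delta_mx ord0 j)).
  apply/funext => u; rewrite fct_sumE {1}[u]row_sum_delta linear_sum.
  by apply: eq_bigr => j _; rewrite linearZ.
apply: differentiable_sum => j.
exact: (differentiableZl (L (delta_mx ord0 j)) (differentiable_coord x ord0 j)).
Qed.

Lemma linear_rV_continuous n (W : normedModType R)
    (L : {linear 'rV[R]_n -> W}) : continuous L.
Proof. by move=> x; apply/differentiable_continuous/linear_rV_differentiable. Qed.

Lemma near_eq_differentiable (V W : normedModType R) (f g : V -> W) x :
  (\near x, f x = g x) -> differentiable f x -> differentiable g x.
Proof.
move=> fg df; rewrite (_ : g = f + (g - f)); last by rewrite addrC subrK.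
apply: (differentiableD df).
have h0 : \forall y \near x, (g - f) y = 0.
  by near=> y; rewrite !fctE (_ : f y = g y) ?subrr//; near: y.
move: (g - f) h0 => h h0 {fg df}.
have hx : h x = 0 by exact: nbhs_singleton h0.
have ho : h \o shift x = cst (h x) + (\0 : V -> W) +o_ 0 id.
  apply/eqaddoP => _/posnumP[e]; rewrite hx.
  have : \forall y \near (0 : V), h (y + x) = 0.
    by move: h0; rewrite (near_shift 0) subr0.
  apply: filterS => y hy.
  by rewrite !fctE /= hy !addr0 ?subrr normr0 mulr_ge0.
have c0 : continuous (\0 : V -> W) by exact: cst_continuous.
by apply/diff_locallyP; rewrite (diff_unique c0 ho).
Unshelve. all: by end_near. Qed.

Lemma eq_diff_on k (V W : normedModType R) (U : set V) (f g : V -> W) :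
  open U -> (forall x, U x -> f x = g x) -> diff_on k U f -> diff_on k U g.
Proof.
move=> oU; have nU x : U x -> nbhs x U by move=> Ux; exact: open_nbhs_nbhs.
elim: k f g => [|k IH] f g fg [df ddf].
  split=> // x Ux; apply: near_eq_differentiable (df x Ux).
  by apply: filterS (nU _ Ux) => y /fg.
split=> [x Ux|v].
  apply: near_eq_differentiable (df x Ux).
  by apply: filterS (nU _ Ux) => y /fg.
apply: IH (ddf v) => x Ux; apply: near_eq_derive.
by apply: filterS (nU _ Ux) => y /fg.
Qed.

Lemma diff_onD k (V W : normedModType R) (U : set V) (f g : V -> W) :
  open U -> diff_on k U f -> diff_on k U g -> diff_on k U (f + g).
Proof.
move=> oU; elim: k f g => [|k IH] f g cf cg.
  by split=> [x Ux|//]; exact: differentiableD (diff_on0 cf Ux) (diff_on0 cg Ux).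
split=> [x Ux|v]; first by exact: differentiableD (diff_on0 cf Ux) (diff_on0 cg Ux).
apply: eq_diff_on oU _ (IH _ _ (cf.2 v) (cg.2 v)) => x Ux.
by rewrite deriveD//; apply: diff_derivable;
  [exact: diff_on0 cf Ux|exact: diff_on0 cg Ux].
Qed.

Lemma smooth_onD (V W : normedModType R) (U : set V) (f g : V -> W) :
  open U -> smooth_on U f -> smooth_on U g -> smooth_on U (f + g).
Proof. by move=> oU sf sg k; exact: diff_onD. Qed.

Lemma diff_onM k (V : normedModType R) (U : set V) (f g : V -> R) :
  open U -> diff_on k U f -> diff_on k U g -> diff_on k U (f * g).
Proof.
move=> oU; elim: k f g => [|k IH] f g cf cg.
  by split=> [x Ux|//]; exact: differentiableM (diff_on0 cf Ux) (diff_on0 cg Ux).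
split=> [x Ux|v]; first by exact: differentiableM (diff_on0 cf Ux) (diff_on0 cg Ux).
have cD := diff_onD oU (IH _ _ (diff_onW cf) (cg.2 v))
                       (IH _ _ (diff_onW cg) (cf.2 v)).
apply: eq_diff_on oU _ cD => x Ux.
by rewrite deriveM//; apply: diff_derivable;
  [exact: diff_on0 cf Ux|exact: diff_on0 cg Ux].
Qed.

Lemma smooth_onM (V : normedModType R) (U : set V) (f g : V -> R) :
  open U -> smooth_on U f -> smooth_on U g -> smooth_on U (f * g).
Proof. by move=> oU sf sg k; exact: diff_onM. Qed.

Lemma smooth_on_cst (V W : normedModType R) (U : set V) (w : W) :
  smooth_on U (cst w).
Proof.
move=> k; elim: k w => [|k IH] w.
  by split=> [x _|//]; exact: differentiable_cst.
split=> [x _|v]; first exact: differentiable_cst.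
by rewrite (_ : 'D_v (cst w) = cst 0)//; apply/funext => x; rewrite derive_cst.
Qed.

Lemma derive_comp_linear m n (W : normedModType R)
    (L : {linear 'rV[R]_m -> 'rV[R]_n}) (f : 'rV[R]_n -> W) v x :
  'D_v (f \o L) x = 'D_(L v) f (L x).
Proof.
rewrite /derive; set u := (X in X @ _); set u' := (X in _ = lim (X @ _)).
suff -> : u = u' by [].
by apply/funext => h; rewrite /u /u' /= (linearD L) linearZ.
Qed.

Lemma smooth_on_pre m n (W : normedModType R) (L : {linear 'rV[R]_m -> 'rV[R]_n})
    (U : set 'rV[R]_n) (f : 'rV[R]_n -> W) :
  smooth_on U f -> smooth_on (L @^-1` U) (f \o L).
Proof.
have dL (g : 'rV[R]_n -> W) x : differentiable g (L x) -> differentiable (g \o L) x.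
  by apply: differentiable_comp; exact: linear_rV_differentiable.
move=> sf k; elim: k f {sf}(sf k) => [|k IH] f [df ddf].
  by split=> [x Ux|//]; apply: dL; exact: df.
split=> [x Ux|v]; first by apply: dL; exact: df.
rewrite (_ : 'D_v (f \o L) = 'D_(L v) f \o L); first by apply: IH; exact: ddf.
by apply/funext => x; rewrite derive_comp_linear.
Qed.

Lemma derive_linear_comp m n (V : normedModType R)
    (L : {linear 'rV[R]_m -> 'rV[R]_n}) (f : V -> 'rV[R]_m) v x :
  differentiable f x -> 'D_v (L \o f) x = L ('D_v f x).
Proof.
move=> df; have cL : continuous L by exact: linear_rV_continuous.
have dL : differentiable L (f x) by exact: linear_rV_differentiable.
rewrite [LHS]deriveE; last exact: differentiable_comp.
by rewrite diff_comp//= diff_lin// deriveE.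
Qed.

Lemma smooth_on_post m n (V : normedModType R) (L : {linear 'rV[R]_m -> 'rV[R]_n})
    (U : set V) (f : V -> 'rV[R]_m) :
  open U -> smooth_on U f -> smooth_on U (L \o f).
Proof.
have dL (g : V -> 'rV[R]_m) x : differentiable g x -> differentiable (L \o g) x.
  by move=> dg; apply: differentiable_comp => //; exact: linear_rV_differentiable.
move=> oU sf k; elim: k f {sf}(sf k) => [|k IH] f cf.
  by split=> [x Ux|//]; exact: dL (diff_on0 cf Ux).
split=> [x Ux|v]; first by exact: dL (diff_on0 cf Ux).
apply: eq_diff_on oU _ (IH _ (cf.2 v)) => x Ux.
by rewrite derive_linear_comp//; exact: diff_on0 cf Ux.
Qed.

Lemma smooth_on_row_mx m1 m2 (V : normedModType R) (U : set V)
    (f : V -> 'rV[R]_m1) (g : V -> 'rV[R]_m2) :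
  open U -> smooth_on U f -> smooth_on U g ->
  smooth_on U (fun x => row_mx (f x) (g x)).
Proof.
move=> oU sf sg.
rewrite (_ : (fun x => _) = (mulmxr (row_mx 1%:M 0) \o f) +
                            (mulmxr (row_mx 0 1%:M) \o g)).
  by apply: smooth_onD => //; exact: smooth_on_post.
apply/funext => x /=; rewrite !fctE/= !mul_mx_row !mulmx0 !mulmx1.
by rewrite add_row_mx addr0 add0r.
Qed.

Lemma continuous_row_mx m1 m2 (T : topologicalType)
    (f : T -> 'rV[R]_m1) (g : T -> 'rV[R]_m2) x :
  {for x, continuous f} -> {for x, continuous g} ->
  {for x, continuous (fun y => row_mx (f y) (g y))}.
Proof.
move=> cf cg.
rewrite (_ : (fun y => _) = ((mulmxr (row_mx 1%:M 0) \o f) +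
                             (mulmxr (row_mx 0 1%:M) \o g))).
  have cL n (A : 'M[R]_(n, m1 + m2)) (h : T -> 'rV[R]_n) :
      {for x, continuous h} -> {for x, continuous (mulmxr A \o h)}.
    by move=> ch; apply: (continuous_comp ch); exact: linear_rV_continuous.
  by apply: (@cvgD _ 'rV[R]_(m1 + m2)); exact: cL.
apply/funext => y /=; rewrite !fctE/= !mul_mx_row !mulmx0 !mulmx1.
by rewrite add_row_mx addr0 add0r.
Qed.

End SmoothMaps.

Record chart (R : realType) (M : topologicalType) (n : nat) := Chart {
  chart_dom : set M;
  coord : M -> 'rV[R]_n;
  param : 'rV[R]_n -> M;
  chart_dom_open : open chart_dom;
  chart_cod_open : open (coord @` chart_dom);
  coordK : forall p, chart_dom p -> param (coord p) = p;
  coord_continuous : forall p, chart_dom p -> {for p, continuous coord};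
  param_continuous :
    forall p, chart_dom p -> {for coord p, continuous param}
}.

Arguments chart_dom_open {R M n} c.
Arguments chart_cod_open {R M n} c.

(* The atlas need not be maximal: all notions below depend only on the smooth
   structure that it generates.  [chart_at] selects a chart around each point,
   in which tangent vectors at that point are written. *)
Record smooth_manifold (R : realType) (n : nat) := SmoothManifold {
  carrier :> topologicalType;
  manifold_hausdorff : hausdorff_space carrier;
  manifold_second_countable : @second_countable carrier;
  atlas : set (chart R carrier n);
  atlas_compat : forall c d, atlas c -> atlas d ->
    smooth_on (coord c @` (chart_dom c `&` chart_dom d)) (coord d \o param c);
  chart_at : carrier -> chart R carrier n;
  chart_at_atlas : forall p, atlas (chart_at p);
  chart_at_dom : forall p, chart_dom (chart_at p) p
}.

Section Calculus.
Context {R : realType} {n : nat} {M : smooth_manifold R n}.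
Implicit Types p : M.

(* A tangent vector at [p] is given by its components in [chart_at p]. *)
Definition tangent p : normedModType R := 'rV[R]_n.

Definition smooth_in_chart (c : chart R M n) (W : normedModType R)
    (F : M -> W) : Prop :=
  smooth_on (coord c @` chart_dom c) (F \o param c).

Definition smooth (W : normedModType R) (F : M -> W) : Prop :=
  forall c, atlas c -> smooth_in_chart c F.

(* [dir_derive F u] is u(F), the action of the tangent vector [u] at [p] on a
   real- or vector-valued function that is smooth near [p]. *)
Definition dir_derive (W : normedModType R) (F : M -> W) p (u : tangent p) : W :=
  'D_u (F \o param (chart_at p)) (coord (chart_at p) p).

(* The vector at [p] whose components in the chart [c] are [v]; for [v] in the
   standard basis these are the coordinate vectors of [c]. *)
Definition coord_vector (c : chart R M n) (v : 'rV[R]_n) p : tangent p :=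
  'D_v (coord (chart_at p) \o param c) (coord c p).

(* Smoothness of the components of [X] in each chart; [coord c] is regarded as
   the vector of its coordinate functions. *)
Definition vector_field (X : forall p, tangent p) : Prop :=
  forall c, atlas c -> smooth_in_chart c (fun p => dir_derive (coord c) (X p)).

(* [X, Y]^k = X(Y(x^k)) - Y(X(x^k)) for the coordinates x^k of [chart_at p]. *)
Definition lie_bracket (X Y : forall p, tangent p) p : tangent p :=
  let x := coord (chart_at p) in
  dir_derive (fun q => dir_derive x (Y q)) (X p) -
  dir_derive (fun q => dir_derive x (X q)) (Y p).

End Calculus.

Arguments tangent {R n M} p.

Definition tangent_map (R : realType) (m n : nat) (M : smooth_manifold R m)
    (N : smooth_manifold R n) (F : M -> N) (p : M) (u : tangent p) :
    tangent (F p) :=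
  dir_derive (coord (chart_at (F p)) \o F) u.

Record pseudo_riemannian (R : realType) (n : nat) := PseudoRiemannian {
  base :> smooth_manifold R n;
  metric : forall p : base, tangent p -> tangent p -> R;
  metric_linear : forall p (k : R) (u v w : tangent p),
    metric (k *: u + v) w = k * metric u w + metric v w;
  metric_sym : forall p (u v : tangent p), metric u v = metric v u;
  metric_nondegenerate : forall p (u : tangent p),
    (forall v, metric u v = 0) -> u = 0;
  metric_smooth : forall (c : chart R base n) (v w : 'rV[R]_n), atlas c ->
    smooth_in_chart c
      (fun p => metric (coord_vector c v p) (coord_vector c w p))
}.

Arguments metric {R n M} p u v : rename.

Section Homothetic.
Context {R : realType} {n : nat} {M : pseudo_riemannian R n}.

(* (L_zeta g)(X, Y) = zeta(g(X, Y)) - g([zeta, X], Y) - g(X, [zeta, Y]) *)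
Definition lie_derivative_metric (zeta X Y : forall p : M, tangent p) (p : M) : R :=
  dir_derive (fun q => metric q (X q) (Y q)) (zeta p)
  - metric p (lie_bracket zeta X p) (Y p)
  - metric p (X p) (lie_bracket zeta Y p).

Definition homothetic (zeta : forall p : M, tangent p) (a : R) : Prop :=
  vector_field zeta /\
  forall X Y : (forall p : M, tangent p), vector_field X -> vector_field Y ->
  forall p, lie_derivative_metric zeta X Y p = a * metric p (X p) (Y p).

End Homothetic.

Section ProductManifold.
Context {R : realType}.

Section ProductChart.
Context {n1 n2 : nat} {M1 M2 : topologicalType}.
Variables (c : chart R M1 n1) (d : chart R M2 n2).

Definition prod_dom : set (M1 * M2) := chart_dom c `*` chart_dom d.

Definition prod_coord (p : M1 * M2) : 'rV[R]_(n1 + n2) :=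
  row_mx (coord c p.1) (coord d p.2).

Definition prod_param (x : 'rV[R]_(n1 + n2)) : M1 * M2 :=
  (param c (lsubmx x), param d (rsubmx x)).

Lemma lsubmx_continuous : continuous (lsubmx : 'rV[R]_(n1 + n2) -> _).
Proof. exact: linear_rV_continuous. Qed.

Lemma rsubmx_continuous : continuous (rsubmx : 'rV[R]_(n1 + n2) -> _).
Proof. exact: linear_rV_continuous. Qed.

Lemma prod_coord_image (A : set M1) (B : set M2) :
  prod_coord @` (A `*` B) =
  lsubmx @^-1` (coord c @` A) `&` rsubmx @^-1` (coord d @` B).
Proof.
apply/seteqP; split=> [x [p [Ap Bp] <-]|x [[p Ap px] [q Bq qx]]].
  by split=> /=; rewrite ?row_mxKl ?row_mxKr; [exists p.1|exists p.2].
by exists (p, q) => //; rewrite /prod_coord/= px qx hsubmxK.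
Qed.

Lemma prod_dom_open : open prod_dom.
Proof.
rewrite openE => -[p q] [/= pc qd].
by exists (chart_dom c, chart_dom d) => //=; split; apply: open_nbhs_nbhs;
  split=> //; exact: chart_dom_open.
Qed.

Lemma prod_cod_open : open (prod_coord @` prod_dom).
Proof.
rewrite prod_coord_image; apply: openI.
  apply: (@open_comp 'rV[R]_(n1 + n2) 'rV[R]_n1 lsubmx _ _ (chart_cod_open c)).
  by move=> x _; exact: lsubmx_continuous.
apply: (@open_comp 'rV[R]_(n1 + n2) 'rV[R]_n2 rsubmx _ _ (chart_cod_open d)).
  by move=> x _; exact: rsubmx_continuous.
Qed.

Lemma prod_coordK p : prod_dom p -> prod_param (prod_coord p) = p.
Proof.
by case: p => p q [pc qd]; rewrite /prod_param row_mxKl row_mxKr !coordK.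
Qed.

Lemma prod_coord_continuous p : prod_dom p -> {for p, continuous prod_coord}.
Proof.
move=> [pc qd]; apply: continuous_row_mx.
  by apply: continuous_comp; [exact: cvg_fst|exact: coord_continuous].
by apply: continuous_comp; [exact: cvg_snd|exact: coord_continuous].
Qed.

Lemma prod_param_continuous p :
  prod_dom p -> {for prod_coord p, continuous prod_param}.
Proof.
move=> [pc qd].
have cl : {for prod_coord p, continuous (param c \o lsubmx)}.
  apply: continuous_comp; first exact: lsubmx_continuous.
  by rewrite row_mxKl; exact: param_continuous.
have cr : {for prod_coord p, continuous (param d \o rsubmx)}.
  apply: continuous_comp; first exact: rsubmx_continuous.
  by rewrite row_mxKr; exact: param_continuous.
exact: cvg_pair cl cr.
Qed.

Definition prod_chart : chart R (M1 * M2)%type (n1 + n2) :=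
  Chart prod_dom_open prod_cod_open prod_coordK prod_coord_continuous
    prod_param_continuous.

End ProductChart.

Lemma prod_hausdorff (T1 T2 : topologicalType) :
  hausdorff_space T1 -> hausdorff_space T2 -> hausdorff_space (T1 * T2)%type.
Proof.
move=> h1 h2 [p1 p2] [q1 q2] pq; congr pair.
- apply: h1 => A B pA qB.
  have [||[x y] [/= Ax Bx]] := pq (A `*` setT) (B `*` setT).
  + by exists (A, setT) => //=; split => //; exact: filterT.
  + by exists (B, setT) => //=; split => //; exact: filterT.
  + by exists x; split; [case: Ax|case: Bx].
- apply: h2 => A B pA qB.
  have [||[x y] [/= Ax Bx]] := pq (setT `*` A) (setT `*` B).
  + by exists (setT, A) => //=; split => //; exact: filterT.
  + by exists (setT, B) => //=; split => //; exact: filterT.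
  + by exists y; split; [case: Ax|case: Bx].
Qed.

Lemma prod_second_countable (T1 T2 : topologicalType) :
  @second_countable T1 -> @second_countable T2 ->
  @second_countable (T1 * T2)%type.
Proof.
move=> [B1 cB1 [oB1 nB1]] [B2 cB2 [oB2 nB2]].
exists ((fun AB => AB.1 `*` AB.2) @` (B1 `*` B2)).
  by apply: card_le_trans (card_image_le _ _) _; exact: countableX.
split.
  move=> _ [[A B] [/= /oB1 oA /oB2 oB] <-]; rewrite openE => -[p q] [/= Ap Bq].
  by exists (A, B) => //=; split; exact: open_nbhs_nbhs.
move=> [p q] C [[A B] /= [/nB1 [A' [B1A' A'p] A'A] /nB2 [B' [B2B' B'q] B'B]] ABC].
exists (A' `*` B').
  by split=> //; exists (A', B').
by move=> [x y] [/= A'x B'y]; apply: ABC; split; [exact: A'A|exact: B'B].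
Qed.

Section Product.
Context {n1 n2 : nat} (M1 : smooth_manifold R n1) (M2 : smooth_manifold R n2).

Definition prod_atlas : set (chart R (M1 * M2)%type (n1 + n2)) :=
  [set prod_chart c d | c in @atlas R n1 M1 & d in @atlas R n2 M2].

Lemma overlap_open n (T : topologicalType) (c d : chart R T n) :
  open (coord c @` (chart_dom c `&` chart_dom d)).
Proof.
rewrite openE => _ [p [pc pd] <-].
have cp : nbhs (coord c p) (coord c @` chart_dom c).
  by apply: open_nbhs_nbhs; split; [exact: chart_cod_open|exists p].
have dp : nbhs (coord c p) (param c @^-1` chart_dom d).
  apply: (param_continuous pc); rewrite coordK//.
  by apply: open_nbhs_nbhs; split=> //; exact: chart_dom_open.
apply: filterS (filterI cp dp) => _ [[q qc <-]] /=.
by rewrite coordK// => qd; exists q.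
Qed.

Lemma prod_compat c d : prod_atlas c -> prod_atlas d ->
  smooth_on (coord c @` (chart_dom c `&` chart_dom d)) (coord d \o param c).
Proof.
move=> [c1 c1A [c2 c2A <-]] [d1 d1A [d2 d2A <-]].
have oU := @overlap_open _ _ (prod_chart c1 c2) (prod_chart d1 d2).
rewrite (_ : _ \o _ = fun x =>
    row_mx ((coord d1 \o param c1 \o lsubmx) x)
           ((coord d2 \o param c2 \o rsubmx) x))//.
have sl := smooth_on_pre (@lsubmx R 1 n1 n2) (atlas_compat c1A d1A).
have sr := smooth_on_pre (@rsubmx R 1 n1 n2) (atlas_compat c2A d2A).
apply: smooth_on_row_mx => //.
- apply: smooth_on_sub sl => _ [p [[p1 p2] [q1 q2]] <-] /=.
  by rewrite row_mxKl; exists p.1.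
- apply: smooth_on_sub sr => _ [p [[p1 p2] [q1 q2]] <-] /=.
  by rewrite row_mxKr; exists p.2.
Qed.

Definition prod_manifold : smooth_manifold R (n1 + n2).
Proof.
refine (@SmoothManifold R (n1 + n2) (M1 * M2)%type
  (prod_hausdorff (@manifold_hausdorff _ _ M1) (@manifold_hausdorff _ _ M2))
  (prod_second_countable (@manifold_second_countable _ _ M1)
     (@manifold_second_countable _ _ M2))
  prod_atlas prod_compat (fun p => prod_chart (chart_at p.1) (chart_at p.2)) _ _).
- by move=> p; exists (chart_at p.1); [exact: chart_at_atlas|];
    exists (chart_at p.2) => //; exact: chart_at_atlas.
- by move=> p; split; exact: chart_at_dom.
Defined.

End Product.
End ProductManifold.


Section DoublyWarped.
Context {R : realType} {n1 n2 : nat}.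

Section Lift.
Variables (M1 : smooth_manifold R n1) (M2 : smooth_manifold R n2).
Let M := prod_manifold M1 M2.

(* [lift1 X] at [(p, q)] is the image of [X p] under the differential of the
   inclusion x |-> (x, q); it projects to [X p] on [M1] and to 0 on [M2]. *)
Definition lift1 (X : forall p : M1, tangent p) (p : M) : tangent p :=
  tangent_map (fun x : M1 => (x, p.2) : M) (X p.1).

Definition lift2 (X : forall p : M2, tangent p) (p : M) : tangent p :=
  tangent_map (fun y : M2 => (p.1, y) : M) (X p.2).

End Lift.

Record warping_function (n : nat) (M : smooth_manifold R n) := WarpingFunction {
  warp :> M -> R;
  warp_smooth : smooth warp;
  warp_pos : forall p, 0 < warp p
}.

Section Projections.
Variables (M1 : smooth_manifold R n1) (M2 : smooth_manifold R n2).
Let M := prod_manifold M1 M2.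

Lemma coordK_near n (T : topologicalType) (c : chart R T n) p :
  chart_dom c p -> \forall x \near coord c p, coord c (param c x) = x.
Proof.
move=> pc; have : nbhs (coord c p) (coord c @` chart_dom c).
  by apply: open_nbhs_nbhs; split; [exact: chart_cod_open|exists p].
by apply: filterS => _ [q qc <-]; rewrite coordK.
Qed.

Lemma tangent_map_fst (p : M) (u : tangent p) :
  tangent_map (fst : M -> M1) u = lsubmx u.
Proof.
have e : 'D_u (@lsubmx R 1 n1 n2) (coord (chart_at p) p) = lsubmx u.
  by rewrite (derive_comp_linear (@lsubmx R 1 n1 n2) id) derive_id.
rewrite -e; apply: near_eq_derive.
have := coordK_near (chart_at_dom p.1).
rewrite -{1}(row_mxKl (coord (chart_at p.1) p.1) (coord (chart_at p.2) p.2)).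
exact: lsubmx_continuous.
Qed.

Lemma tangent_map_snd (p : M) (u : tangent p) :
  tangent_map (snd : M -> M2) u = rsubmx u.
Proof.
have e : 'D_u (@rsubmx R 1 n1 n2) (coord (chart_at p) p) = rsubmx u.
  by rewrite (derive_comp_linear (@rsubmx R 1 n1 n2) id) derive_id.
rewrite -e; apply: near_eq_derive.
have := coordK_near (chart_at_dom p.2).
rewrite -{1}(row_mxKr (coord (chart_at p.1) p.1) (coord (chart_at p.2) p.2)).
exact: rsubmx_continuous.
Qed.

Lemma transition_differentiable n (N : smooth_manifold R n) (c d : chart R N n) p :
  atlas c -> atlas d -> chart_dom c p -> chart_dom d p ->
  differentiable (coord d \o param c) (coord c p).
Proof.
move=> cA dA pc pd; apply: (diff_on0 (atlas_compat cA dA 0)).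
by exists p.
Qed.

Lemma tangent_map_coord_vector (c : chart R M1 n1) (d : chart R M2 n2)
    (v : 'rV[R]_(n1 + n2)) (p : M) :
  atlas c -> atlas d -> chart_dom c p.1 -> chart_dom d p.2 ->
  tangent_map (fst : M -> M1) (coord_vector (prod_chart c d : chart R M _) v p) =
    coord_vector c (lsubmx v) p.1 /\
  tangent_map (snd : M -> M2) (coord_vector (prod_chart c d : chart R M _) v p) =
    coord_vector d (rsubmx v) p.2.
Proof.
move=> cA dA pc pd; pose cd : chart R M (n1 + n2) := prod_chart c d.
have df : differentiable (coord (chart_at p) \o param cd) (coord cd p).
  apply: transition_differentiable; [|exact: chart_at_atlas|by split|
    exact: chart_at_dom].
  by exists c => //; exists d.
rewrite tangent_map_fst tangent_map_snd; split.
- rewrite -[LHS](derive_linear_comp (@lsubmx R 1 n1 n2) _ df).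
  rewrite (_ : _ \o _ = (coord (chart_at p.1) \o param c) \o @lsubmx R 1 n1 n2).
    by rewrite derive_comp_linear /coord_vector /= row_mxKl.
  by apply/funext => x /=; rewrite row_mxKl.
- rewrite -[LHS](derive_linear_comp (@rsubmx R 1 n1 n2) _ df).
  rewrite (_ : _ \o _ = (coord (chart_at p.2) \o param d) \o @rsubmx R 1 n1 n2).
    by rewrite derive_comp_linear /coord_vector /= row_mxKr.
  by apply/funext => x /=; rewrite row_mxKr.
Qed.

End Projections.

Variables (M1 : pseudo_riemannian R n1) (M2 : pseudo_riemannian R n2).
Variables (f1 : warping_function M1) (f2 : warping_function M2).

Definition dw_metric (p : prod_manifold M1 M2) (u v : tangent p) : R :=
  f2 p.2 ^+ 2 *
    metric p.1 (tangent_map (fst : prod_manifold M1 M2 -> M1) u)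
               (tangent_map (fst : prod_manifold M1 M2 -> M1) v) +
  f1 p.1 ^+ 2 *
    metric p.2 (tangent_map (snd : prod_manifold M1 M2 -> M2) u)
               (tangent_map (snd : prod_manifold M1 M2 -> M2) v).

Let M := prod_manifold M1 M2.

Lemma metric0r n (N : pseudo_riemannian R n) (p : N) (u : tangent p) :
  metric p u 0 = 0.
Proof.
have e := metric_linear 1 0 0 u; rewrite scale1r addr0 mul1r in e.
by rewrite metric_sym; apply: (addrI (metric p 0 u)); rewrite addr0 -e.
Qed.

Lemma dw_metric_linear (p : M) (k : R) (u v w : tangent p) :
  dw_metric (k *: u + v) w = k * dw_metric u w + dw_metric v w.
Proof.
rewrite /dw_metric !tangent_map_fst !tangent_map_snd.
rewrite (linearP (@lsubmx R 1 n1 n2)) (linearP (@rsubmx R 1 n1 n2)).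
rewrite !metric_linear !mulrDr addrACA; congr (_ + _).
by rewrite -!mulrA !(mulrCA k).
Qed.

Lemma dw_metric_sym (p : M) (u v : tangent p) :
  dw_metric u v = dw_metric v u.
Proof.
rewrite /dw_metric [in LHS](@metric_sym _ _ M1) [in LHS](@metric_sym _ _ M2).
reflexivity.
Qed.

Lemma dw_metric_nondegenerate (p : M) (u : tangent p) :
  (forall v, dw_metric u v = 0) -> u = 0.
Proof.
rewrite /dw_metric !tangent_map_fst !tangent_map_snd => u0.
have sq0 n (N : smooth_manifold R n) (f : warping_function N) q :
  f q ^+ 2 != 0 by rewrite expf_neq0// gt_eqF// warp_pos.
have ul : lsubmx u = 0.
  apply: (@metric_nondegenerate R n1 M1 p.1) => v.
  have := u0 (row_mx v 0); rewrite tangent_map_fst tangent_map_snd.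
  rewrite row_mxKl row_mxKr metric0r mulr0 addr0 => /eqP.
  by rewrite mulf_eq0 (negPf (sq0 _ _ _ _)) => /eqP.
have ur : rsubmx u = 0.
  apply: (@metric_nondegenerate R n2 M2 p.2) => v.
  have := u0 (row_mx 0 v); rewrite tangent_map_fst tangent_map_snd.
  rewrite row_mxKl row_mxKr metric0r mulr0 add0r => /eqP.
  by rewrite mulf_eq0 (negPf (sq0 _ _ _ _)) => /eqP.
by rewrite -[u]hsubmxK ul ur row_mx0.
Qed.

Lemma dw_metric_smooth (c : chart R M (n1 + n2)) (v w : 'rV[R]_(n1 + n2)) :
  atlas c -> smooth_in_chart c
    (fun p => dw_metric (coord_vector c v p) (coord_vector c w p)).
Proof.
move=> [c1 c1A [c2 c2A <-]] k.
have oU := chart_cod_open (prod_chart c1 c2).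
have pre1 (F : M1 -> R) : smooth_in_chart c1 F ->
    smooth_on (coord (prod_chart c1 c2) @` chart_dom (prod_chart c1 c2))
      ((F \o param c1) \o @lsubmx R 1 n1 n2).
  move=> /(smooth_on_pre (@lsubmx R 1 n1 n2)); apply: smooth_on_sub.
  by move=> _ [p [p1 p2] <-] /=; rewrite row_mxKl; exists p.1.
have pre2 (F : M2 -> R) : smooth_in_chart c2 F ->
    smooth_on (coord (prod_chart c1 c2) @` chart_dom (prod_chart c1 c2))
      ((F \o param c2) \o @rsubmx R 1 n1 n2).
  move=> /(smooth_on_pre (@rsubmx R 1 n1 n2)); apply: smooth_on_sub.
  by move=> _ [p [p1 p2] <-] /=; rewrite row_mxKr; exists p.2.
have sf1 := pre1 _ (warp_smooth f1 c1A).
have sf2 := pre2 _ (warp_smooth f2 c2A).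
have sg1 := pre1 _ (metric_smooth (lsubmx v) (lsubmx w) c1A).
have sg2 := pre2 _ (metric_smooth (rsubmx v) (rsubmx w) c2A).
have sg := smooth_onD oU (smooth_onM oU (smooth_onM oU sf2 sf2) sg1)
                         (smooth_onM oU (smooth_onM oU sf1 sf1) sg2).
apply: (eq_diff_on oU _ (sg k)) => _ [p [p1 p2] <-] /=.
rewrite /dw_metric prod_coordK; last by split.
have [ev1 ev2] := tangent_map_coord_vector v c1A c2A p1 p2.
have [ew1 ew2] := tangent_map_coord_vector w c1A c2A p1 p2.
by rewrite ev1 ev2 ew1 ew2 !fctE /= !row_mxKl !row_mxKr !coordK.
Qed.

Definition doubly_warped_product : pseudo_riemannian R (n1 + n2) :=
  @PseudoRiemannian R (n1 + n2) M dw_metric dw_metric_linear dw_metric_sym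
    dw_metric_nondegenerate dw_metric_smooth.

End DoublyWarped.

(* Main.v *)
(* In the chart [c] chosen at [p], the derivatives of the test fields [X], [Y]
   cancel against the Lie brackets, so that
     (L_zeta g)(X, Y) = zeta(g(d_u, d_v)) + g(D_u zeta, v) + g(u, D_v zeta)
   with u = X(p), v = Y(p), where d_u, d_v are the constant fields of [c] and
   zeta is written in components.  On the product chart each of the three terms
   splits into a2 f2^2 times the term of (zeta1, g1) plus a1 f1^2 times the term
   of (zeta2, g2), since f1 and f2 are constant along zeta.  To use the hypotheses
   on the factors, [X] and [Y] are restricted to the slices through [p] and
   projected, which gives vector fields on M1 and M2 with the required values at
   [p]; no bump functions are needed to extend tangent vectors. *)
Require Import Defs.
From mathcomp Require Import all_boot all_order all_algebra.
From mathcomp Require Import reals topology normedtype derive.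
From mathcomp Require Import boolp classical_sets functions ring.

Import numFieldNormedType.Exports.

Local Open Scope ring_scope.

Set Implicit Arguments.
Unset Strict Implicit.
Unset Printing Implicit Defensive.

Import Order.TTheory GRing.Theory Num.Theory.

Local Open Scope classical_set_scope.

(* [coord] and [metric_sym] are shadowed by the later imports *)
Local Notation coord := Defs.coord.
Local Notation metric_sym := Defs.metric_sym.

(** * Directional derivatives: affine substitutions and bilinear expressions *)

Section Calculus.
Context {R : realType}.

Lemma derive_vectorZ (V W : normedModType R) (f : V -> W) (k : R) (v x : V) :
  differentiable f x -> 'D_(k *: v) f x = k *: 'D_v f x.
Proof. by move=> df; rewrite !deriveE// linearZ. Qed.

Lemma derive_comp_affine m n (W : normedModType R)
    (L : {linear 'rV[R]_m -> 'rV[R]_n}) (b : 'rV[R]_n) (f : 'rV[R]_n -> W) v x :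
  'D_v (fun y => f (L y + b)) x = 'D_(L v) f (L x + b).
Proof.
rewrite /derive; set u := (X in X @ _); set u' := (X in _ = lim (X @ _)).
suff -> : u = u' by [].
by apply/funext => h; rewrite /u /u' /= (linearD L) linearZ addrA.
Qed.

(** In product charts the inclusion of a slice is affine rather than linear, hence the shift [b].
    The induction on the order closes because the derivative along [v] is ['D_(L v) f] composed with
    the same affine map. *)
Lemma smooth_on_comp_affine m n (W : normedModType R)
    (L : {linear 'rV[R]_m -> 'rV[R]_n}) (b : 'rV[R]_n)
    (U : set 'rV[R]_n) (f : 'rV[R]_n -> W) :
  smooth_on U f ->
  smooth_on ((fun y => L y + b) @^-1` U) (fun y => f (L y + b)).
Proof.
have dL (g : 'rV[R]_n -> W) x : differentiable g (L x + b) ->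
    differentiable (g \o (fun y => L y + b)) x.
  move=> dg.
  apply: (@differentiable_comp R 'rV[R]_m 'rV[R]_n W (fun y => L y + b) g x _ dg).
  exact: differentiableD (linear_rV_differentiable L x) (differentiable_cst b x).
move=> sf k; elim: k f {sf}(sf k) => [|k IH] f [df ddf].
  by split=> [x Ux|//]; apply: dL; exact: df.
split=> [x Ux|v]; first by apply: dL; exact: df.
rewrite (_ : 'D_v _ = (fun y => 'D_(L v) f (L y + b))).
  exact: (IH ('D_(L v) f) (ddf (L v))).
by apply/funext => x; rewrite derive_comp_affine.
Qed.

(** Leibniz rule for a varying bilinear form, with matrix [G], evaluated on two varying vectors; a
    metric has this shape in a chart. *)
Lemma derive_bilinear_sum n (V : normedModType R) (a b : V -> 'rV[R]_n)
    (G : 'I_n -> 'I_n -> V -> R) (x w : V) :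
  derivable a x w -> derivable b x w -> (forall i j, derivable (G i j) x w) ->
  'D_w (fun y => \sum_i \sum_j a y ord0 i * b y ord0 j * G i j y) x =
  \sum_i \sum_j (a x ord0 i * b x ord0 j * 'D_w (G i j) x +
    'D_w a x ord0 i * b x ord0 j * G i j x +
    a x ord0 i * 'D_w b x ord0 j * G i j x).
Proof.
move=> da db dG.
have dai i : derivable (fun y => a y ord0 i) x w.
  exact: (@derivable_mxP R V 1 n a x w).1 da ord0 i.
have dbi i : derivable (fun y => b y ord0 i) x w.
  exact: (@derivable_mxP R V 1 n b x w).1 db ord0 i.
rewrite (_ : (fun y => _) = \sum_i \sum_j
    ((fun y => a y ord0 i) * (fun y => b y ord0 j) * G i j)); last first.
  by apply/funext => y; rewrite fct_sumE; apply: eq_bigr => i _; rewrite fct_sumE.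
have dm i j : derivable ((fun y => a y ord0 i) * (fun y => b y ord0 j) * G i j) x w.
  by exact: (derivableM (derivableM (dai i) (dbi j)) (dG i j)).
rewrite derive_sum; last first.
  by move=> i; apply: derivable_sum; exact: dm.
apply: eq_bigr => i _; rewrite derive_sum; last exact: dm.
apply: eq_bigr => j _.
rewrite (deriveM (derivableM (dai i) (dbi j)) (dG i j)).
rewrite (deriveM (dai i) (dbi j)) (derive_mx da) (derive_mx db).
rewrite !mxE /GRing.scale/= !fctE.
ring.
Qed.

End Calculus.

(** * Components of tangent vectors and change of chart *)

Section Charts.
Context {R : realType} {n : nat} {M : smooth_manifold R n}.
Implicit Types (c d : chart R M n) (p : M).

Lemma chart_dom_near c p :
  chart_dom c p -> \forall x \near coord c p, chart_dom c (param c x).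
Proof.
move=> pc; have : nbhs (coord c p) (coord c @` chart_dom c).
  by apply: open_nbhs_nbhs; split; [exact: chart_cod_open|exists p].
by apply: filterS => _ [q qc <-]; rewrite coordK.
Qed.

Lemma smooth_in_chart_differentiable c (W : normedModType R) (F : M -> W) p :
  smooth_in_chart c F -> chart_dom c p ->
  differentiable (F \o param c) (coord c p).
Proof. by move=> /(_ 0) sF pc; apply: (diff_on0 sF); exists p. Qed.

(** Chain rule: the two transition maps compose to the identity near [coord c p], so their
    differentials compose to the identity. *)
Lemma derive_transitionK c d p (v : 'rV[R]_n) :
  atlas c -> atlas d -> chart_dom c p -> chart_dom d p ->
  'D_('D_v (coord d \o param c) (coord c p)) (coord c \o param d) (coord d p) = v.
Proof.
move=> cA dA pc pd.
have dcd := transition_differentiable cA dA pc pd.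
have ddc := transition_differentiable dA cA pd pc.
have e : (coord d \o param c) (coord c p) = coord d p by rewrite /= coordK.
have dp : \forall x \near coord c p, chart_dom d (param c x).
  apply: (param_continuous pc); rewrite coordK//.
  by apply: open_nbhs_nbhs; split=> //; exact: chart_dom_open.
transitivity ('D_v ((coord c \o param d) \o (coord d \o param c)) (coord c p)).
  rewrite -e in ddc; rewrite -e [RHS](deriveE _ (differentiable_comp dcd ddc)).
  by rewrite (diff_comp dcd ddc) [LHS](deriveE _ ddc) (deriveE _ dcd).
rewrite -[RHS](derive_id (coord c p) v); apply: near_eq_derive.
have := coordK_near pc; move: dp; apply: filterS2 => x dx cx.
by rewrite /= coordK.
Qed.

(** Allows a field to be rewritten near a point through its components in one fixed chart, although
    [tangent q] refers to a chart that varies with [q]. *)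
Lemma dir_derive_coordK c p (u : tangent p) : atlas c -> chart_dom c p ->
  coord_vector c (dir_derive (coord c) u) p = u.
Proof.
move=> cA pc; apply: derive_transitionK => //.
- exact: chart_at_atlas.
- exact: chart_at_dom.
Qed.

Lemma coord_vector_chart_at p (v : 'rV[R]_n) : coord_vector (chart_at p) v p = v.
Proof.
rewrite -[RHS](derive_id (coord (chart_at p) p) v); apply: near_eq_derive.
exact/coordK_near/chart_at_dom.
Qed.

Lemma dir_derive_coord_chart_at p (u : tangent p) :
  dir_derive (coord (chart_at p)) u = u.
Proof. exact: coord_vector_chart_at. Qed.

(** As a function of [v], [coord_vector c v p] is the differential of a transition map, hence
    linear. *)
Lemma coord_vectorE c p (v : 'rV[R]_n) : atlas c -> chart_dom c p ->
  coord_vector c v p =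
  \sum_i v ord0 i *: (coord_vector c (delta_mx ord0 i) p : 'rV[R]_n).
Proof.
move=> cA pc.
have dT := transition_differentiable cA (chart_at_atlas p) pc (chart_at_dom p).
rewrite /coord_vector deriveE// {1}[v]row_sum_delta linear_sum.
by apply: eq_bigr => i _; rewrite linearZ deriveE.
Qed.

End Charts.

(** * The Lie derivative of the metric in coordinates *)

Section LieDerivative.
Context {R : realType} {n : nat} {M : pseudo_riemannian R n}.
Implicit Types (c : chart R M n) (p : M).

Lemma metric_suml p (I : Type) (r : seq I) (k : I -> R) (u : I -> 'rV[R]_n)
    (w : tangent p) :
  metric p (\sum_(i <- r) k i *: u i : 'rV[R]_n) w =
  \sum_(i <- r) k i * metric p (u i) w.
Proof.
elim: r => [|i r IH]; first by rewrite !big_nil metric_sym metric0r.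
by rewrite !big_cons metric_linear IH.
Qed.

Lemma metric_sumr p (I : Type) (r : seq I) (k : I -> R) (u : I -> 'rV[R]_n)
    (w : tangent p) :
  metric p w (\sum_(i <- r) k i *: u i : 'rV[R]_n) =
  \sum_(i <- r) k i * metric p w (u i).
Proof.
rewrite metric_sym metric_suml; apply: eq_bigr => i _; congr (_ * _).
exact: metric_sym.
Qed.

Lemma metric_coord_vector c p (v w : 'rV[R]_n) : atlas c -> chart_dom c p ->
  metric p (coord_vector c v p) (coord_vector c w p) =
  \sum_i \sum_j v ord0 i * w ord0 j *
    metric p (coord_vector c (delta_mx ord0 i) p)
             (coord_vector c (delta_mx ord0 j) p).
Proof.
move=> cA pc; rewrite (coord_vectorE v)// (coord_vectorE w)// metric_suml.
apply: eq_bigr => i _; rewrite metric_sumr mulr_sumr.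
by apply: eq_bigr => j _; rewrite mulrA.
Qed.

Lemma metric_components p (v w : tangent p) :
  metric p v w = \sum_i \sum_j (v : 'rV[R]_n) ord0 i * (w : 'rV[R]_n) ord0 j *
    metric p (coord_vector (chart_at p) (delta_mx ord0 i) p)
             (coord_vector (chart_at p) (delta_mx ord0 j) p).
Proof.
rewrite -metric_coord_vector ?coord_vector_chart_at//.
- exact: chart_at_atlas.
- exact: chart_at_dom.
Qed.

(** Both sides are expanded by the Leibniz rule in the chart at [p]. With [a] and [b] frozen at [p],
    only the derivatives of the metric coefficients survive; the last two terms come from the
    varying components. *)
Lemma dir_derive_metric p (a b : M -> 'rV[R]_n) (w : tangent p) :
  let c := chart_at p in
  differentiable (a \o param c) (coord c p) ->
  differentiable (b \o param c) (coord c p) ->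
  dir_derive (fun q => metric q (coord_vector c (a q) q)
                                (coord_vector c (b q) q)) w =
  dir_derive (fun q => metric q (coord_vector c (a p) q)
                                (coord_vector c (b p) q)) w +
  metric p (dir_derive a w) (b p) + metric p (a p) (dir_derive b w).
Proof.
move=> c.
have cA : atlas c by exact: chart_at_atlas.
have pc : chart_dom c p by exact: chart_at_dom.
pose G i j := (fun q => metric q (coord_vector c (delta_mx ord0 i) q)
             (coord_vector c (delta_mx ord0 j) q)) \o param c.
have dG i j : derivable (G i j) (coord c p) w.
  apply/diff_derivable/smooth_in_chart_differentiable => //.
  exact: metric_smooth.
(* Used twice: for [a] and [b], and for the constant maps with the same values at [p]. *)
have expand (a' b' : M -> 'rV[R]_n) :
    differentiable (a' \o param c) (coord c p) ->
    differentiable (b' \o param c) (coord c p) ->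
    dir_derive (fun q => metric q (coord_vector c (a' q) q)
                                  (coord_vector c (b' q) q)) w =
    \sum_i \sum_j (a' p ord0 i * b' p ord0 j * 'D_w (G i j) (coord c p) +
      (dir_derive a' w : 'rV[R]_n) ord0 i * b' p ord0 j * G i j (coord c p) +
      a' p ord0 i * (dir_derive b' w : 'rV[R]_n) ord0 j * G i j (coord c p)).
  move=> da db.
  have := @derive_bilinear_sum R n _ (a' \o param c) (b' \o param c) G
            (coord c p) w (diff_derivable da) (diff_derivable db) dG.
  rewrite /= coordK// => <-; apply: near_eq_derive.
  by apply: filterS (chart_dom_near pc) => x xc /=; exact: metric_coord_vector.
move=> da db; rewrite (expand a b da db) 
  (expand (cst (a p)) (cst (b p)) (differentiable_cst _ _) (differentiable_cst _ _)).
rewrite [X in _ = _ + X + _]metric_components [X in _ = _ + X]metric_components.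
rewrite -!big_split; apply: eq_bigr => i _.
rewrite -!big_split; apply: eq_bigr => j _ /=.
have D0 (k : 'rV[R]_n) : dir_derive (cst k) w = 0 by exact: derive_cst.
rewrite !D0 /G /= (coordK pc) !mxE.
ring.
Qed.

Lemma lie_derivative_metricE (zeta X Y : forall p : M, tangent p) (p : M) :
  vector_field zeta -> vector_field X -> vector_field Y ->
  let c := chart_at p in
  lie_derivative_metric zeta X Y p =
  dir_derive (fun q => metric q (coord_vector c (X p) q)
                                (coord_vector c (Y p) q)) (zeta p) +
  metric p (dir_derive (fun q => dir_derive (coord c) (zeta q)) (X p)) (Y p) +
  metric p (X p) (dir_derive (fun q => dir_derive (coord c) (zeta q)) (Y p)).
Proof.
move=> sz sX sY c.
have cA : atlas c by exact: chart_at_atlas.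
have pc : chart_dom c p by exact: chart_at_dom.
have dX := smooth_in_chart_differentiable (sX c cA) pc.
have dY := smooth_in_chart_differentiable (sY c cA) pc.
have mBl (u v w : tangent p) :
    metric p (u - v : 'rV[R]_n) w = metric p u w - metric p v w.
  by rewrite addrC -scaleN1r metric_linear mulN1r addrC.
have mBr (u v w : tangent p) :
    metric p w (u - v : 'rV[R]_n) = metric p w u - metric p w v.
  by rewrite metric_sym mBl (metric_sym u) (metric_sym v).
(* Bilinearity splits each bracket; brackets at [p] are computed in this same chart [c]. *)
have -> : lie_derivative_metric zeta X Y p =
    dir_derive (fun q => metric q (X q) (Y q)) (zeta p) -
    (metric p (dir_derive (fun q => dir_derive (coord c) (X q)) (zeta p)) (Y p) -
     metric p (dir_derive (fun q => dir_derive (coord c) (zeta q)) (X p)) (Y p)) -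
    (metric p (X p) (dir_derive (fun q => dir_derive (coord c) (Y q)) (zeta p)) -
     metric p (X p) (dir_derive (fun q => dir_derive (coord c) (zeta q)) (Y p))).
  by rewrite -mBl -mBr.
(* Only values near [p] matter, and there both fields are recovered from their components in the
   single chart [c]. *)
have -> : dir_derive (fun q => metric q (X q) (Y q)) (zeta p) = dir_derive (fun q =>
    metric q (coord_vector c (dir_derive (coord c) (X q)) q)
             (coord_vector c (dir_derive (coord c) (Y q)) q)) (zeta p).
  apply: near_eq_derive; apply: filterS (chart_dom_near pc) => x xc /=.
  by rewrite !(dir_derive_coordK _ cA xc).
rewrite (dir_derive_metric _ dX dY) !dir_derive_coord_chart_at.
(* [B] and [C] are the terms in which the test fields are differentiated along [zeta]. *)
have key (A B C D E : R) : A + B + C - (B - D) - (C - E) = A + D + E by ring.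
exact: key.
Qed.

End LieDerivative.

(** * Lifts to a product manifold and restrictions to its slices *)

Section Product.
Context {R : realType} {n1 n2 : nat}.
Variables (M1 : smooth_manifold R n1) (M2 : smooth_manifold R n2).
Local Notation M := (prod_manifold M1 M2).
Local Notation inl_mx := (row_mx 1%:M 0 : 'M[R]_(n1, n1 + n2)).
Local Notation inr_mx := (row_mx 0 1%:M : 'M[R]_(n2, n1 + n2)).

(** Presents the map sending [x] to [row_mx x y] as a linear map plus a constant, ready for affine
    substitution. *)
Lemma mulmx_inl_affine (x : 'rV[R]_n1) (y : 'rV[R]_n2) :
  mulmxr inl_mx x + row_mx 0 y = row_mx x y.
Proof. by rewrite /= mul_mx_row mulmx0 mulmx1 add_row_mx addr0 add0r. Qed.

Lemma mulmx_inr_affine (x : 'rV[R]_n1) (y : 'rV[R]_n2) :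
  mulmxr inr_mx y + row_mx x 0 = row_mx x y.
Proof. by rewrite /= mul_mx_row mulmx0 mulmx1 add_row_mx addr0 add0r. Qed.

(** In the charts at [p.1] and [p] the inclusion of the slice is affine with linear part [inl_mx],
    so its differential pads with zeros. *)
Lemma lift1E (X : forall p : M1, tangent p) (p : M) :
  lift1 X p = row_mx (X p.1 : 'rV[R]_n1) (0 : 'rV[R]_n2).
Proof.
pose y := coord (chart_at p.2) p.2.
transitivity ('D_(X p.1) (fun x => mulmxr inl_mx x + row_mx 0 y)
    (coord (chart_at p.1) p.1)).
  apply: near_eq_derive; apply: filterS (coordK_near (chart_at_dom p.1)) => x xE.
  by rewrite mulmx_inl_affine /= /prod_coord /= xE.
by rewrite (derive_comp_affine (mulmxr inl_mx) _ id) derive_id /=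
  mul_mx_row mulmx0 mulmx1.
Qed.

Lemma lift2E (X : forall p : M2, tangent p) (p : M) :
  lift2 X p = row_mx (0 : 'rV[R]_n1) (X p.2 : 'rV[R]_n2).
Proof.
pose y := coord (chart_at p.1) p.1.
transitivity ('D_(X p.2) (fun x => mulmxr inr_mx x + row_mx y 0)
    (coord (chart_at p.2) p.2)).
  apply: near_eq_derive; apply: filterS (coordK_near (chart_at_dom p.2)) => x xE.
  by rewrite mulmx_inr_affine /= /prod_coord /= xE.
by rewrite (derive_comp_affine (mulmxr inr_mx) _ id) derive_id /=
  mul_mx_row mulmx0 mulmx1.
Qed.

(** A transition map between product charts acts separately on the two blocks of coordinates, so its
    differential is block diagonal. *)
Lemma dir_derive_prod_coord (c : chart R M1 n1) (d : chart R M2 n2) (p : M)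
    (u : tangent p) :
  atlas c -> atlas d -> chart_dom c p.1 -> chart_dom d p.2 ->
  dir_derive (coord (prod_chart c d : chart R M _)) u =
  row_mx (@dir_derive R n1 M1 _ (coord c) p.1 (lsubmx u))
         (@dir_derive R n2 M2 _ (coord d) p.2 (rsubmx u)).
Proof.
move=> cA dA pc pd; pose cd : chart R M (n1 + n2) := prod_chart c d.
have cdA : atlas cd by exists c => //; exists d.
have pcd : chart_dom cd p by split.
have df := transition_differentiable (chart_at_atlas p) cdA (chart_at_dom p) pcd.
rewrite -[LHS]hsubmxK; congr row_mx.
- rewrite -[LHS](derive_linear_comp (@lsubmx R 1 n1 n2) _ df).
  rewrite (_ : _ \o _ = (coord c \o param (chart_at p.1)) \o @lsubmx R 1 n1 n2).
    by rewrite derive_comp_linear /dir_derive /= row_mxKl.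
  by apply/funext => x /=; rewrite row_mxKl.
- rewrite -[LHS](derive_linear_comp (@rsubmx R 1 n1 n2) _ df).
  rewrite (_ : _ \o _ = (coord d \o param (chart_at p.2)) \o @rsubmx R 1 n1 n2).
    by rewrite derive_comp_linear /dir_derive /= row_mxKr.
  by apply/funext => x /=; rewrite row_mxKr.
Qed.

(** The components of the slice field in [c] are the left block of those of [X] in the product of
    [c] with the chart at [q], composed with the affine inclusion of the slice; smoothness is
    inherited from [X]. *)
Lemma vector_field_slice1 (X : forall p : M, tangent p) (q : M2) :
  vector_field X ->
  vector_field (fun x : M1 => lsubmx (X (x, q) : 'rV[R]_(n1 + n2)) : tangent x).
Proof.
move=> sX c cA k; pose d := chart_at q.
have dA : atlas d by exact: chart_at_atlas.
have qd : chart_dom d q by exact: chart_at_dom.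
have cdA : atlas (prod_chart c d : chart R M _) by exists c => //; exists d.
have := smooth_on_comp_affine (mulmxr inl_mx) (row_mx 0 (coord d q)) (sX _ cdA).
have UV : coord c @` chart_dom c `<=`
    (fun x => mulmxr inl_mx x + row_mx 0 (coord d q)) @^-1`
    (coord (prod_chart c d : chart R M _) @`
     chart_dom (prod_chart c d : chart R M _)).
  by move=> _ [r rc <-]; exists (r, q) => //; rewrite mulmx_inl_affine.
move/(smooth_on_sub UV)/(smooth_on_post (@lsubmx R 1 n1 n2) (chart_cod_open c)).
move=> /(_ k); apply: eq_diff_on (chart_cod_open c) _ => _ [r rc <-].
rewrite [in LHS]/comp mulmx_inl_affine /comp.
have -> : param (prod_chart c d : chart R M _)
    (row_mx (coord c r) (coord d q)) = (r, q).
  by rewrite /= /prod_param row_mxKl row_mxKr !coordK.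
by rewrite dir_derive_prod_coord// [LHS]row_mxKl coordK.
Qed.

Lemma vector_field_slice2 (X : forall p : M, tangent p) (q : M1) :
  vector_field X ->
  vector_field (fun y : M2 => rsubmx (X (q, y) : 'rV[R]_(n1 + n2)) : tangent y).
Proof.
move=> sX d dA k; pose c := chart_at q.
have cA : atlas c by exact: chart_at_atlas.
have qc : chart_dom c q by exact: chart_at_dom.
have cdA : atlas (prod_chart c d : chart R M _) by exists c => //; exists d.
have := smooth_on_comp_affine (mulmxr inr_mx) (row_mx (coord c q) 0) (sX _ cdA).
have UV : coord d @` chart_dom d `<=`
    (fun x => mulmxr inr_mx x + row_mx (coord c q) 0) @^-1`
    (coord (prod_chart c d : chart R M _) @`
     chart_dom (prod_chart c d : chart R M _)).
  by move=> _ [r rd <-]; exists (q, r) => //; rewrite mulmx_inr_affine.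
move/(smooth_on_sub UV)/(smooth_on_post (@rsubmx R 1 n1 n2) (chart_cod_open d)).
move=> /(_ k); apply: eq_diff_on (chart_cod_open d) _ => _ [r rd <-].
rewrite [in LHS]/comp mulmx_inr_affine /comp.
have -> : param (prod_chart c d : chart R M _)
    (row_mx (coord c q) (coord d r)) = (q, r).
  by rewrite /= /prod_param row_mxKl row_mxKr !coordK.
by rewrite dir_derive_prod_coord// [LHS]row_mxKr coordK.
Qed.

End Product.

(** * Linear combinations of lifted fields: smoothness and derivatives *)

Section ProductField.
Context {R : realType} {n1 n2 : nat}.
Variables (M1 : smooth_manifold R n1) (M2 : smooth_manifold R n2).
Local Notation M := (prod_manifold M1 M2).
Variables (Z1 : forall p : M1, tangent p) (Z2 : forall p : M2, tangent p).
Variables a b : R.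
Hypotheses (sZ1 : vector_field Z1) (sZ2 : vector_field Z2).

Lemma lift_combinationE (p : M) :
  a *: lift1 Z1 p + b *: lift2 Z2 p =
  row_mx (a *: Z1 p.1 : 'rV[R]_n1) (b *: Z2 p.2 : 'rV[R]_n2).
Proof.
rewrite lift1E lift2E.
by rewrite [LHS](_ : _ = a *: row_mx (Z1 p.1 : 'rV[R]_n1) (0 : 'rV[R]_n2) +
  b *: row_mx (0 : 'rV[R]_n1) (Z2 p.2 : 'rV[R]_n2))// !scale_row_mx !scaler0
  add_row_mx addr0 add0r.
Qed.

Lemma dir_derive_coordZ n (N : smooth_manifold R n) (c : chart R N n) (q : N)
    (u : tangent q) (k : R) : atlas c -> chart_dom c q ->
  dir_derive (coord c) (k *: u) = k *: dir_derive (coord c) u.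
Proof.
move=> cA qc; apply: derive_vectorZ; apply: transition_differentiable => //.
- exact: chart_at_atlas.
- exact: chart_at_dom.
Qed.

(** Scaling is written as [mulmxr] by a scalar matrix so that the results on composition with a
    linear map apply to it. *)
Lemma dir_derive_coord_lift (c : chart R M1 n1) (d : chart R M2 n2) (p : M) :
  atlas c -> atlas d -> chart_dom c p.1 -> chart_dom d p.2 ->
  dir_derive (coord (prod_chart c d : chart R M _))
    (a *: lift1 Z1 p + b *: lift2 Z2 p) =
  row_mx (mulmxr a%:M (dir_derive (coord c) (Z1 p.1)))
         (mulmxr b%:M (dir_derive (coord d) (Z2 p.2))).
Proof.
move=> cA dA pc pd.
rewrite (dir_derive_prod_coord _ cA dA pc pd) lift_combinationE row_mxKl row_mxKr.
rewrite (dir_derive_coordZ (Z1 p.1) a cA pc) (dir_derive_coordZ (Z2 p.2) b dA pd).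
by rewrite /mulmxr !mul_mx_scalar.
Qed.

Lemma vector_field_lift :
  vector_field (fun p : M => a *: lift1 Z1 p + b *: lift2 Z2 p).
Proof.
move=> _ [c cA [d dA <-]] k.
have oU := chart_cod_open (prod_chart c d).
have s1 := smooth_on_pre (@lsubmx R 1 n1 n2) (sZ1 cA).
have s2 := smooth_on_pre (@rsubmx R 1 n1 n2) (sZ2 dA).
have UV1 : coord (prod_chart c d) @` chart_dom (prod_chart c d) `<=`
    lsubmx @^-1` (coord c @` chart_dom c).
  by move=> _ [q [q1 q2] <-] /=; rewrite row_mxKl; exists q.1.
have UV2 : coord (prod_chart c d) @` chart_dom (prod_chart c d) `<=`
    rsubmx @^-1` (coord d @` chart_dom d).
  by move=> _ [q [q1 q2] <-] /=; rewrite row_mxKr; exists q.2.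
have s1' := smooth_on_post (mulmxr a%:M) oU (smooth_on_sub UV1 s1).
have s2' := smooth_on_post (mulmxr b%:M) oU (smooth_on_sub UV2 s2).
apply: eq_diff_on oU _ (smooth_on_row_mx oU s1' s2' k) => _ [q [q1 q2] <-].
have e : (fun p => dir_derive (coord (prod_chart c d : chart R M _))
    (a *: lift1 Z1 p + b *: lift2 Z2 p)) (param (prod_chart c d)
      (coord (prod_chart c d) q)) = row_mx
      (mulmxr a%:M (dir_derive (coord c) (Z1 q.1)))
      (mulmxr b%:M (dir_derive (coord d) (Z2 q.2))).
  by rewrite coordK; [exact: dir_derive_coord_lift|split].
by rewrite [RHS]e /= row_mxKl row_mxKr !coordK.
Qed.

(** The components of [Z1] depend only on the first block of coordinates and those of [Z2] only on
    the second, so no mixed derivatives occur. *)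
Lemma dir_derive_lift (p : M) (u : tangent p) :
  dir_derive (fun q : M => dir_derive (coord (chart_at p))
    (a *: lift1 Z1 q + b *: lift2 Z2 q)) u =
  row_mx (a *: @dir_derive R n1 M1 _
            (fun q => dir_derive (coord (chart_at p.1)) (Z1 q)) p.1 (lsubmx u))
         (b *: @dir_derive R n2 M2 _
            (fun q => dir_derive (coord (chart_at p.2)) (Z2 q)) p.2 (rsubmx u)).
Proof.
pose c := chart_at p.1; pose d := chart_at p.2.
have cA : atlas c by exact: chart_at_atlas.
have dA : atlas d by exact: chart_at_atlas.
have pc : chart_dom c p.1 by exact: chart_at_dom.
have pd : chart_dom d p.2 by exact: chart_at_dom.
have pcd : chart_dom (chart_at p) p by exact: chart_at_dom.
have dZ := smooth_in_chart_differentiable (vector_field_lift (chart_at_atlas p)) pcd.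
have dZ1 := smooth_in_chart_differentiable (sZ1 cA) pc.
have dZ2 := smooth_in_chart_differentiable (sZ2 dA) pd.
rewrite -[LHS]hsubmxK; congr row_mx.
- rewrite -[LHS](derive_linear_comp (@lsubmx R 1 n1 n2) _ dZ).
  transitivity ('D_u (mulmxr a%:M \o
      ((fun q => dir_derive (coord c) (Z1 q)) \o param c) \o @lsubmx R 1 n1 n2)
      (coord (chart_at p) p)).
    apply: near_eq_derive; apply: filterS (chart_dom_near pcd) => x [xc xd].
    by rewrite /comp (dir_derive_coord_lift cA dA xc xd) [LHS]row_mxKl.
  have e : lsubmx (coord (chart_at p) p) = coord c p.1 by exact: row_mxKl.
  rewrite -e in dZ1; rewrite derive_comp_linear (derive_linear_comp _ _ dZ1).
  by rewrite e; exact: mul_mx_scalar.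
- rewrite -[LHS](derive_linear_comp (@rsubmx R 1 n1 n2) _ dZ).
  transitivity ('D_u (mulmxr b%:M \o
      ((fun q => dir_derive (coord d) (Z2 q)) \o param d) \o @rsubmx R 1 n1 n2)
      (coord (chart_at p) p)).
    apply: near_eq_derive; apply: filterS (chart_dom_near pcd) => x [xc xd].
    by rewrite /comp (dir_derive_coord_lift cA dA xc xd) [LHS]row_mxKr.
  have e : rsubmx (coord (chart_at p) p) = coord d p.2 by exact: row_mxKr.
  rewrite -e in dZ2; rewrite derive_comp_linear (derive_linear_comp _ _ dZ2).
  by rewrite e; exact: mul_mx_scalar.
Qed.

End ProductField.

(** * The doubly warped metric: its derivative and its values on block vectors *)

Section WarpedMetric.
Context {R : realType} {n1 n2 : nat}.
Variables (M1 : pseudo_riemannian R n1) (M2 : pseudo_riemannian R n2).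
Variables (f1 : warping_function M1) (f2 : warping_function M2).
Local Notation M := (prod_manifold M1 M2).

Lemma derive_sqr_mul (V : normedModType R) (f g : V -> R) (x w : V) :
  derivable f x w -> derivable g x w -> 'D_w f x = 0 ->
  'D_w (f * f * g) x = f x ^+ 2 * 'D_w g x.
Proof.
move=> df dg f0; rewrite (deriveM (derivableM df df) dg) (deriveM df df) f0.
by rewrite !scaler0 addr0 scaler0 addr0 expr2.
Qed.

(** Each summand of the metric is the squared warping function of one factor times a function on the
    other. The hypotheses make the squared function behave as a constant, and the remaining
    derivative sees only one block of the direction. *)
Lemma dir_derive_dw_metric (p : M) (u v : 'rV[R]_(n1 + n2))
    (z1 : tangent p.1) (z2 : tangent p.2) (a b : R) :
  dir_derive f1 z1 = 0 -> dir_derive f2 z2 = 0 ->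
  @dir_derive R _ M _ (fun q => dw_metric f1 f2
      (coord_vector (chart_at p) u q) (coord_vector (chart_at p) v q)) p
    (row_mx (a *: z1 : 'rV[R]_n1) (b *: z2 : 'rV[R]_n2)) =
  f2 p.2 ^+ 2 * (a * dir_derive (fun q => metric q
      (coord_vector (chart_at p.1) (lsubmx u) q)
      (coord_vector (chart_at p.1) (lsubmx v) q)) z1) +
  f1 p.1 ^+ 2 * (b * dir_derive (fun q => metric q
      (coord_vector (chart_at p.2) (rsubmx u) q)
      (coord_vector (chart_at p.2) (rsubmx v) q)) z2).
Proof.
move=> f10 f20; pose c := chart_at p.1; pose d := chart_at p.2.
have cA : atlas c by exact: chart_at_atlas.
have dA : atlas d by exact: chart_at_atlas.
have pc : chart_dom c p.1 by exact: chart_at_dom.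
have pd : chart_dom d p.2 by exact: chart_at_dom.
have pcd : chart_dom (chart_at p) p by exact: chart_at_dom.
set w := row_mx _ _; set x := coord (chart_at p) p.
have wl : lsubmx w = (a *: z1 : tangent p.1) by exact: row_mxKl.
have xl : lsubmx x = coord c p.1 by exact: row_mxKl.
have wr : rsubmx w = (b *: z2 : tangent p.2) by exact: row_mxKr.
have xr : rsubmx x = coord d p.2 by exact: row_mxKr.
(* A function pulled back from [M1] is differentiated only by the first block [a *: z1] of [w]. *)
have D1 (F : M1 -> R) : smooth_in_chart c F ->
    derivable (F \o param c \o @lsubmx R 1 n1 n2) x w /\
    'D_w (F \o param c \o @lsubmx R 1 n1 n2) x = a * dir_derive F z1.
  move=> sF; have dF := smooth_in_chart_differentiable sF pc.
  have e : 'D_w (F \o param c \o @lsubmx R 1 n1 n2) x =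
      'D_(lsubmx w) (F \o param c) (lsubmx x) by exact: derive_comp_linear.
  split; last by rewrite e xl wl; exact: derive_vectorZ.
  rewrite -xl in dF; apply: diff_derivable.
  exact: differentiable_comp (linear_rV_differentiable (@lsubmx R 1 n1 n2) x) dF.
have D2 (F : M2 -> R) : smooth_in_chart d F ->
    derivable (F \o param d \o @rsubmx R 1 n1 n2) x w /\
    'D_w (F \o param d \o @rsubmx R 1 n1 n2) x = b * dir_derive F z2.
  move=> sF; have dF := smooth_in_chart_differentiable sF pd.
  have e : 'D_w (F \o param d \o @rsubmx R 1 n1 n2) x =
      'D_(rsubmx w) (F \o param d) (rsubmx x) by exact: derive_comp_linear.
  split; last by rewrite e xr wr; exact: derive_vectorZ.
  rewrite -xr in dF; apply: diff_derivable.
  exact: differentiable_comp (linear_rV_differentiable (@rsubmx R 1 n1 n2) x) dF.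
have [df1 Df1] := D1 _ (warp_smooth f1 cA).
have [df2 Df2] := D2 _ (warp_smooth f2 dA).
have [dg1 Dg1] := D1 _ (metric_smooth (lsubmx u) (lsubmx v) cA).
have [dg2 Dg2] := D2 _ (metric_smooth (rsubmx u) (rsubmx v) dA).
(* Both warping functions are stationary along [w], whatever [a] and [b] are. *)
rewrite f10 mulr0 in Df1; rewrite f20 mulr0 in Df2.
move: (derive_sqr_mul df2 dg1 Df2) (derive_sqr_mul df1 dg2 Df1).
rewrite Dg1 Dg2 /comp xl xr !coordK// => <- <-.
rewrite -deriveD; last 2 first.
- exact: derivableM (derivableM df2 df2) dg1.
- exact: derivableM (derivableM df1 df1) dg2.
(* Near [p] the coordinate fields of the product chart project to coordinate fields of the
   factors. *)
apply: near_eq_derive; apply: filterS (chart_dom_near pcd) => y [yc yd].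
rewrite /comp /dw_metric.
have [u1 u2] := tangent_map_coord_vector u cA dA yc yd.
have [v1 v2] := tangent_map_coord_vector v cA dA yc yd.
have m1 := congr2 (metric (param c (lsubmx y))) u1 v1.
have m2 := congr2 (metric (param d (rsubmx y))) u2 v2.
apply: etrans (congr2 (fun r s => f2 (param d (rsubmx y)) ^+ 2 * r +
                                  f1 (param c (lsubmx y)) ^+ 2 * s) m1 m2) _.
by rewrite !expr2.
Qed.

Lemma metricZl n (N : pseudo_riemannian R n) (q : N) (k : R) (u v : tangent q) :
  metric q (k *: u) v = k * metric q u v.
Proof.
by rewrite -[k *: u]addr0 metric_linear [metric q 0 v]metric_sym metric0r addr0.
Qed.

(** Serves the term in which a derivative of [zeta], already split into blocks, is paired with a
    test vector. *)
Lemma dw_metric_rowl (p : M) (u1 : tangent p.1) (u2 : tangent p.2) (a b : R)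
    (v : tangent p) :
  @dw_metric R n1 n2 M1 M2 f1 f2 p
    (row_mx (a *: u1 : 'rV[R]_n1) (b *: u2 : 'rV[R]_n2)) v =
  f2 p.2 ^+ 2 * (a * metric p.1 u1 (lsubmx v)) +
  f1 p.1 ^+ 2 * (b * metric p.2 u2 (rsubmx v)).
Proof.
rewrite /dw_metric !tangent_map_fst !tangent_map_snd row_mxKl row_mxKr.
by congr (_ * _ + _ * _); exact: metricZl.
Qed.

Lemma dw_metric_rowr (p : M) (u1 : tangent p.1) (u2 : tangent p.2) (a b : R)
    (v : tangent p) :
  @dw_metric R n1 n2 M1 M2 f1 f2 p v
    (row_mx (a *: u1 : 'rV[R]_n1) (b *: u2 : 'rV[R]_n2)) =
  f2 p.2 ^+ 2 * (a * metric p.1 (lsubmx v) u1) +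
  f1 p.1 ^+ 2 * (b * metric p.2 (rsubmx v) u2).
Proof.
rewrite dw_metric_sym dw_metric_rowl.
by congr (_ * (_ * _) + _ * (_ * _)); exact: metric_sym.
Qed.

End WarpedMetric.

(** * Comparison of the Lie derivative on the product with those on the factors *)

Theorem theorem4 (R : realType) (n1 n2 : nat)
    (M1 : pseudo_riemannian R n1) (M2 : pseudo_riemannian R n2)
    (f1 : warping_function M1) (f2 : warping_function M2)
    (zeta1 : forall p : M1, tangent p) (zeta2 : forall p : M2, tangent p)
    (a1 a2 : R) :
  homothetic zeta1 a1 ->
  homothetic zeta2 a2 ->
  (forall p : M1, dir_derive f1 (zeta1 p) = 0) ->
  (forall p : M2, dir_derive f2 (zeta2 p) = 0) ->
  homothetic (M := doubly_warped_product f1 f2)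
    (fun p => a2 *: lift1 zeta1 p + a1 *: lift2 zeta2 p) (a1 * a2).
Proof.
move=> [sz1 hz1] [sz2 hz2] f10 f20.
have sz := vector_field_lift a2 a1 sz1 sz2.
(* [p] is made an explicit pair so that [(p.1, p.2)] is convertible to [p] *)
split=> // X Y sX sY [p1 p2]; pose p : prod_manifold M1 M2 := (p1, p2).
(* At [p] the slice fields take as values the blocks of [X p] and [Y p], so [h1] and [h2] concern
   exactly the vectors that occur on the product. *)
pose X1 := vector_field_slice1 p.2 sX; pose Y1 := vector_field_slice1 p.2 sY.
pose X2 := vector_field_slice2 p.1 sX; pose Y2 := vector_field_slice2 p.1 sY.
have h1 := hz1 _ _ X1 Y1 p.1; have h2 := hz2 _ _ X2 Y2 p.2.
rewrite (lie_derivative_metricE p.1 sz1 X1 Y1) in h1.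
rewrite (lie_derivative_metricE p.2 sz2 X2 Y2) in h2.
rewrite (lie_derivative_metricE (M := doubly_warped_product f1 f2) p sz sX sY).
have e1 := dir_derive_dw_metric (X p) (Y p) a2 a1 (f10 p.1) (f20 p.2).
(* [L1 u] and [L2 u] are the blocks, before scaling by [a2] and [a1], of the derivative of [zeta]
   along [u]. *)
pose L1 (u : 'rV[R]_(n1 + n2)) := @dir_derive R n1 M1 _
  (fun q => dir_derive (coord (chart_at p.1)) (zeta1 q)) p.1 (lsubmx u).
pose L2 (u : 'rV[R]_(n1 + n2)) := @dir_derive R n2 M2 _
  (fun q => dir_derive (coord (chart_at p.2)) (zeta2 q)) p.2 (rsubmx u).
have e2 := @dw_metric_rowl R n1 n2 M1 M2 f1 f2 p (L1 (X p)) (L2 (X p)) a2 a1 (Y p).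
have e3 := @dw_metric_rowr R n1 n2 M1 M2 f1 f2 p (L1 (Y p)) (L2 (Y p)) a2 a1 (X p).
rewrite -lift_combinationE in e1.
(* [F1], [F2] stand for the squared warping functions and [m1], [m2] for the values of the factor
   metrics. The identity on [M1], with constant [a1], is weighted by [a2], and the one on [M2], with
   constant [a2], by [a1], so both acquire [a1 * a2]. *)
have key (F1 F2 A1 A2 A3 B1 B2 B3 m1 m2 : R) :
    A1 + A2 + A3 = a1 * m1 -> B1 + B2 + B3 = a2 * m2 ->
    F2 * (a2 * A1) + F1 * (a1 * B1) + (F2 * (a2 * A2) + F1 * (a1 * B2)) +
    (F2 * (a2 * A3) + F1 * (a1 * B3)) = a1 * a2 * (F2 * m1 + F1 * m2).
  move=> hA hB.
  rewrite (_ : _ + _ = F2 * a2 * (A1 + A2 + A3) + F1 * a1 * (B1 + B2 + B3)).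
    by rewrite hA hB; ring.
  by ring.
have e4 : metric (M := doubly_warped_product f1 f2) p (X p) (Y p) =
    f2 p.2 ^+ 2 * metric p.1 (lsubmx (X p)) (lsubmx (Y p)) +
    f1 p.1 ^+ 2 * metric p.2 (rsubmx (X p)) (rsubmx (Y p)).
  by rewrite -[LHS]/(dw_metric f1 f2 (X p) (Y p)) /dw_metric
    !tangent_map_fst !tangent_map_snd.
rewrite -/p e4; apply: etrans (key _ _ _ _ _ _ _ _ _ _ h1 h2).
(* First the derivative of the metric along [zeta], then the two terms in which [zeta] is
   differentiated along [X p] and [Y p]. *)
congr (_ + _ + _).
- exact: e1.
- pose g w := @dw_metric R n1 n2 M1 M2 f1 f2 p w (Y p).
  exact: (etrans (congr1 g (dir_derive_lift a2 a1 sz1 sz2 (X p))) e2).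
- pose g w := @dw_metric R n1 n2 M1 M2 f1 f2 p (X p) w.
  exact: (etrans (congr1 g (dir_derive_lift a2 a1 sz1 sz2 (Y p))) e3).
Qed.
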